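(* Consider the Downward-Closed Prophet problem in which every item value $X_i$ takes values in $\{0,1\}$. There is a deterministic online algorithm for this problem that achieves a competitive ratio of $O(\log n)$.
   Context: Downward-Closed Prophet: there are $n$ items with independently (not necessarily identically) distributed values $X_i\sim\mathcal{D}_i$, $i=1,\dots,n$. Let $\mathcal{F}$ be an arbitrary downward-closed family of subsets of $[n]$ (the feasible sets). The algorithm receives $n$, $\mathcal{F}$ and the distributions $\mathcal{D}_i$ as input, and observes the realizations of $X_1,X_2,\dots,X_n$ one at a time in this order. Starting from $W=\emptyset$, after observing $X_i$ the algorithm must decide immediately and irrevocably whether to add $i$ to $W$, subject to $W$ remaining in $\mathcal{F}$. The algorithm's value is $\sum_{i\in W}X_i$. The competitive ratio of an algorithm is the worst case, over all instances, of the ratio $\mathbb{E}[\max_{S\in\mathcal{F}}\sum_{i\in S}X_i]/\mathbb{E}[\sum_{i\in W}X_i]$. *)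

(* Defs.v *)
From HB Require Import structures.
From mathcomp Require Import all_boot all_order all_algebra.
From mathcomp Require Import all_classical all_reals all_analysis.

Set Implicit Arguments.
Unset Strict Implicit.
Unset Printing Implicit Defensive.

Import Order.TTheory GRing.Theory Num.Theory.
Local Open Scope classical_set_scope.
Local Open Scope ring_scope.

Definition downward_closed (n : nat) (F : {set {set 'I_n}}) : Prop :=
  forall A B : {set 'I_n}, A \subset B -> B \in F -> A \in F.

Definition mutually_independent (R : realType) (d : measure_display)
    (T : measurableType d) (P : probability T R) (n : nat)
    (X : 'I_n -> {RV P >-> R}) : Prop :=
  forall (J : {set 'I_n}) (B : 'I_n -> set R),
    (forall i, measurable (B i)) ->
    P (\bigcap_(i in [set` J]) (X i @^-1` B i)) =
    (\prod_(i in J) P (X i @^-1` B i))%E.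

(* The empty set is the initial value of W, so it has to be feasible; for a
   downward-closed family this only says that the family is nonempty. *)
Record prophet_instance (R : realType) (n : nat) := ProphetInstance {
  feasible : {set {set 'I_n}};
  feasible0 : (finset.set0 : {set 'I_n}) \in feasible;
  feasible_down : downward_closed feasible;
  sample_display : measure_display;
  sample_space : measurableType sample_display;
  sample_prob : probability sample_space R;
  item_value : 'I_n -> {RV sample_prob >-> R};
  item_indep : mutually_independent item_value }.

Definition item_distribution (R : realType) (n : nat)
    (I : prophet_instance R n) (i : 'I_n) : probability R R :=
  distribution (sample_prob I) (item_value I i).

Definition realization (R : realType) (n : nat) (I : prophet_instance R n)
    (w : sample_space I) : 'I_n -> R :=
  fun i => item_value I i w.

Definition zero_one_valued (R : realType) (n : nat)
    (I : prophet_instance R n) : Prop :=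
  forall i w, item_value I i w = 0 \/ item_value I i w = 1.

(* [A n F D i s] tells whether item [i] is added to W when the input is n, F
   and the distributions D, and s = [:: X_0; ...; X_i] are the values observed
   so far.  The earlier decisions of a deterministic algorithm are determined
   by s, hence are not passed separately. *)
Definition online_algorithm (R : realType) : Type :=
  forall n : nat, {set {set 'I_n}} ->
    ('I_n -> probability R R) -> 'I_n -> seq R -> bool.

Definition observed (R : realType) (n : nat) (x : 'I_n -> R) (k : nat) :
    seq R :=
  [seq x j | j <- take k (enum 'I_n)].

(* The set W after the first k items, when the realized values are x. *)
Definition selected (R : realType) (A : online_algorithm R) (n : nat)
    (I : prophet_instance R n) (x : 'I_n -> R) (k : nat) : {set 'I_n} :=
  finset (fun i : 'I_n => (i < k)%N &&
    A n (feasible I) (item_distribution I) i (observed x i.+1)).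

Definition respects_constraints (R : realType) (A : online_algorithm R)
    (n : nat) (I : prophet_instance R n) : Prop :=
  forall (w : sample_space I) (k : nat), (k <= n)%N ->
    selected A I (realization w) k \in feasible I.

Definition expected_value (R : realType) (A : online_algorithm R) (n : nat)
    (I : prophet_instance R n) : \bar R :=
  'E_(sample_prob I)[fun w =>
    (\sum_(i in selected A I (realization w) n) realization w i)%R]%E.

(* The default value 0 of the maximum is the value of the feasible set0. *)
Definition expected_optimum (R : realType) (n : nat)
    (I : prophet_instance R n) : \bar R :=
  'E_(sample_prob I)[fun w =>
    (\big[Num.max/0]_(S in feasible I) \sum_(i in S) realization w i)%R]%E.

(* Division in \bar R: c / 0 = +oo for c > 0, and 0 / 0 = 0 * +oo = 0, so that
   instances whose optimum is 0 impose no constraint on the supremum. *)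
Definition competitive_ratio (R : realType) (A : online_algorithm R) (n : nat)
    (K : prophet_instance R n -> Prop) : \bar R :=
  ereal_sup [set r : \bar R | exists2 I : prophet_instance R n,
    K I & r = (expected_optimum I / expected_value A I)%E].

(* Main.v *)
Require Import Defs.
From mathcomp Require Import all_boot all_order all_algebra.
From mathcomp Require Import all_classical all_reals all_analysis.
From mathcomp Require Import ring lra.

                                                                               
                                                                               
                                                                             
                                                                                
                                                                              
                                                                  
                                                                               
                                                                                

Set Implicit Arguments.
Unset Strict Implicit.
Unset Printing Implicit Defensive.

Import Order.TTheory GRing.Theory Num.Theory.
Local Open Scope ring_scope.

(** With values in {0,1}, an instance is a random set [S] of active items, item [i] being active
    independently with probability [p i], and the offline optimum is the largest size of a feasible
    subset of [S]. The proof runs a potential argument on a partition function [Z(W)], the sum over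
    the future sets [T] with [W :|: T] feasible of the product of [e * p i] over [T].

    The optimum is controlled by [ln Z]: Jensen's inequality gives [E[rank] <= ln E[exp rank]], and
    [E[exp rank] <= Z] ([subset_mean_extension_rank]). The algorithm accepts an active item exactly
    when doing so is feasible and keeps at least a fraction [theta] of [Z]. An accepted item costs
    at most [- ln theta] of potential and earns 1. Passing over a rejected item of probability [p i]
    costs at most [e * theta * p i]. Hence the expected gain is at least [(ln Z - e * theta * sum p
    i) / (e - ln theta)] ([ler_policy_mean]).

    Each item that is feasible alone has [p i] at most the expected optimum, so
    [theta = 1 / (2 e n)] makes the loss from rejections at most half of the optimum, while
    [e - ln theta] is [ln n] plus a constant ([policy_mean_lower_bound]). Independence transfers the
    statement to arbitrary instances ([expectation_active]). *)

Section RandomSubset.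

(** * Averages over a random subset with independent coordinates *)

Variables (R : realType) (I : finType).
Implicit Types (p : I -> R) (F : {set {set I}}) (l : seq I).
Implicit Types (S T W : {set I}) (g h : {set I} -> R) (i j : I).

                                                                             
                           
(** Expectation of [g] at a random subset of [l], computed one coin at a time, so that inductions
    along the arrival order need no measure theory. *)
Fixpoint subset_mean p l g : R :=
  if l is i :: l' then
    (1 - p i) * subset_mean p l' g + p i * subset_mean p l' (fun S => g (i |: S))
  else g finset.set0.

(** The subsets of [i :: l] split according to whether they contain [i]. Those that do are reindexed
    by [S |-> i |: S], which is injective on subsets of [l] because [i] is fresh. *)
Lemma subset_mean_sum p l g : uniq l ->
  subset_mean p l g =
  \sum_(S : {set I} | S \subset l)
    g S * \prod_(i <- l) (if i \in S then p i else 1 - p i).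
Proof.
elim: l g => [|i l IHl] g /=.
  move=> _; rewrite (big_pred1 finset.set0) ?big_nil ?mulr1 // => S.
  by apply/fintype.subsetP/eqP => [S0|-> x]; [apply/setP => x; rewrite finset.inE;
    apply/negP => /S0 | rewrite finset.inE].
move=> /andP[il ul]; rewrite !IHl // [RHS](bigID (fun S => i \in S)) /= [RHS]addrC.
have notin S : S \subset l -> i \notin S.
  by move=> /fintype.subsetP Sl; apply: contra il => /Sl.
rewrite !big_distrr /=; congr (_ + _).
  apply: eq_big => [S|S Sl].
    apply/idP/andP => [Sl|[/fintype.subsetP Sl iS]].
      split; last exact: notin.
      by apply: (fintype.subset_trans Sl); apply/fintype.subsetP => j; rewrite inE orbC => ->.
    apply/fintype.subsetP => j jS; move: (Sl _ jS); rewrite inE => /predU1P[ji|//].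
    by rewrite -ji jS in iS.
  by rewrite big_cons (negPf (notin _ Sl)) mulrCA.
rewrite [RHS](reindex_onto (fun S => i |: S) (fun S => S :\ i)) /=; last first.
  by move=> S /andP[_ iS]; rewrite finset.setD1K.
apply: eq_big => [S|S Sl].
  rewrite setU11 andbT; apply/idP/andP => [Sl|[/fintype.subsetP Sl /eqP iS]].
    split; last by rewrite setU1K ?notin.
    apply/fintype.subsetP => j; rewrite in_setU1 inE => /predU1P[->|]; first by rewrite eqxx.
    by move/(fintype.subsetP Sl) => ->; rewrite orbT.
  apply/fintype.subsetP => j jS; have := Sl j; rewrite in_setU1 jS orbT inE => /(_ isT).
  by case/predU1P=> // ji; move: jS; rewrite -iS ji setD11.
rewrite big_cons setU11 mulrCA; congr (_ * (_ * _)).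
apply: eq_big_seq => j jl; rewrite in_setU1; case: eqP => // ji.
by rewrite -ji jl in il.
Qed.

Section Mean.
Variables (p : I -> R).
Hypothesis p01 : forall i, 0 <= p i <= 1.

Lemma ler_subset_mean l g h :
  (forall S, S \subset l -> g S <= h S) ->
  subset_mean p l g <= subset_mean p l h.
Proof.
elim: l g h => [|i l IHl] g h gh /=; first by apply: gh; apply/fintype.subsetP => x; rewrite finset.inE.
have [p0 p1] := andP (p01 i).
have sub S : S \subset l -> S \subset i :: l /\ i |: S \subset i :: l.
  move=> /fintype.subsetP Sl; split; apply/fintype.subsetP => j; rewrite ?in_setU1 inE.
    by move=> /Sl ->; rewrite orbT.
  by case/predU1P=> [->|/Sl ->]; rewrite ?eqxx ?orbT.
by apply: lerD; apply: ler_wpM2l; rewrite ?subr_ge0 // IHl // => S /sub[? ?];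
  apply: gh.
Qed.

Lemma eq_subset_mean l g h :
  (forall S, S \subset l -> g S = h S) ->
  subset_mean p l g = subset_mean p l h.
Proof.
by move=> gh; apply/le_anti/andP; split; apply: ler_subset_mean => S /gh ->.
Qed.

Lemma subset_mean_ge0 l g : (forall S, 0 <= g S) -> 0 <= subset_mean p l g.
Proof.
move=> g0; elim: l g g0 => [|i l IHl] g g0 //=.
by have [p0 p1] := andP (p01 i); rewrite addr_ge0 // mulr_ge0 ?subr_ge0 // IHl.
Qed.

Lemma subset_mean_lin l (a b : R) g :
  subset_mean p l (fun S => a * g S + b) = a * subset_mean p l g + b.
Proof.
elim: l g => [|i l IHl] g //=.
by rewrite !(IHl (fun S => g (_ S)), IHl); ring.
Qed.

Lemma subset_mean_add l g h :
  subset_mean p l (fun S => g S + h S) = subset_mean p l g + subset_mean p l h.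
Proof. by elim: l g h => [|i l IHl] g h //=; rewrite !IHl; ring. Qed.

Lemma subset_mean_mem l i : uniq l -> i \in l ->
  subset_mean p l (fun S => (i \in S)%:R) = p i.
Proof.
have mean1 l' : subset_mean p l' (fun=> 1) = 1.
  by elim: l' => //= j l' ->; ring.
elim: l => //= j l IHl /andP[jl ul]; rewrite inE => /predU1P[->|il].
  rewrite (@eq_subset_mean _ _ (fun S => 0 * 1 + 0)) => [|S Sl]; last first.
    by rewrite mul0r addr0; case: (boolP (j \in S)) => // /(fintype.subsetP Sl) jl'; rewrite jl' in jl.
  rewrite subset_mean_lin (@eq_subset_mean _ _ (fun=> 1)) => [|S _]; last by rewrite setU11.
  by rewrite mean1; ring.
rewrite IHl // (@eq_subset_mean _ (fun S => (i \in j |: S)%:R) (fun S => (i \in S)%:R)) ?IHl //.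
  ring.
by move=> S _; rewrite in_setU1; case: eqP => // ij; rewrite -ij il in jl.
Qed.

(** Jensen's inequality for the exponential. *)
Lemma expR_subset_mean l g :
  expR (subset_mean p l g) <= subset_mean p l (fun S => expR (g S)).
Proof.
set m := subset_mean p l g.
(* [expR m] is the mean of the tangent line of the exponential at [m], which lies below the
   exponential pointwise. *)
have -> : expR m = subset_mean p l (fun S => expR m * g S + expR m * (1 - m)).
  by rewrite subset_mean_lin -/m; ring.
apply: ler_subset_mean => S _.
have := expR_ge1Dx (g S - m); rewrite -(ler_pM2l (expR_gt0 m)) -expRD.
by rewrite [m + _]addrC subrK; apply: le_trans; rewrite le_eqVlt; apply/orP; left; apply/eqP; ring.
Qed.

End Mean.

(** * How much of a random set can still be added *)

Definition down_closed F :=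
  forall A B : {set I}, A \subset B -> B \in F -> A \in F.

Definition extension_rank F W S : nat :=
  \max_(T : {set I} | (T \subset S) && (W :|: T \in F)) #|T|.

Lemma leq_extension_rank F W S T :
  T \subset S -> W :|: T \in F -> (#|T| <= extension_rank F W S)%N.
Proof.
by move=> TS WT; rewrite /extension_rank (bigD1 T) ?TS //= leq_maxl.
Qed.

(** An optimal [T] either omits [i] and is counted by the first term, or contains it. In the latter
    case [i |: W] is feasible by downward closure, and [T :\ i] extends it with one element fewer,
    whence the factor [expR 1]. *)
Lemma expR_extension_rank F W S i : down_closed F ->
  expR (extension_rank F W (i |: S))%:R <=
  expR (extension_rank F W S)%:R +
  (if i |: W \in F then expR 1 * expR (extension_rank F (i |: W) S)%:R else 0) :> R.
Proof.
move=> dF; set r := extension_rank F W (i |: S).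
(* A rank of 0 may be the default value of a maximum over no sets, so a maximizer is extracted only
   when the rank is positive. *)
have [r0|r_gt0] := posnP r.
  rewrite r0 (@le_trans _ _ (expR (extension_rank F W S)%:R)) ?ler_expR ?ler0n //.
  by rewrite lerDl; case: ifP => // _; rewrite mulr_ge0 ?expR_ge0.
have [T /andP[TS WT] rT] : {T : {set I} | (T \subset i |: S) && (W :|: T \in F) & r = #|T|}.
  have [T0|] := pickP (fun T : {set I} => (T \subset i |: S) && (W :|: T \in F)).
    by move=> P; rewrite /r /extension_rank; apply: eq_bigmax_cond; apply/card_gt0P; exists T0.
  by move=> P0; move: r_gt0; rewrite /r /extension_rank big_pred0.
rewrite {}rT; have [iT|iT] := boolP (i \in T).
  have iW : i |: W \in F.
    by apply: dF WT; rewrite finset.subUset finset.sub1set inE iT orbT finset.subsetUl.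
  rewrite iW -expRD (cardsD1 i) iT natrD.
  apply: ler_wpDl; rewrite ?expR_ge0 // ler_expR lerD2l ler_nat leq_extension_rank //.
    by rewrite subDset.
  by rewrite -finset.setUA finset.setUCA finset.setD1K.
apply: ler_wpDr; first by case: ifP => // _; rewrite mulr_ge0 ?expR_ge0.
rewrite ler_expR ler_nat leq_extension_rank //.
apply/fintype.subsetP => j jT; have := fintype.subsetP TS j jT; rewrite in_setU1 => /predU1P[ji|//].
by rewrite -ji jT in iT.
Qed.


                                                                              
                                                                             
                                                        
(** * The partition function and the threshold policy *)

(** For [F] downward closed, [W] feasible and [l] without repetition and disjoint from [W], this is
    the sum of the products of [expR 1 * p i] over the subsets [T] of [l] with [W :|: T] in [F].
    Equivalently, it is the mean over the random [S] of the sum of [expR #|T|] over such [T] inside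
    [S]. *)
Fixpoint partition_function p F l W : R :=
  if l is i :: l' then
    partition_function p F l' W +
    (if i |: W \in F then expR 1 * p i * partition_function p F l' (i |: W) else 0)
  else 1.

Definition accepts p F (theta : R) l W i : bool :=
  (i |: W \in F) &&
  (theta * partition_function p F l W <= partition_function p F l (i |: W)).

(** [l] lists the items still to come. The decision on the head compares partition functions of the
    tail, hence uses only the distributions of later items. *)
Fixpoint policy p F (theta : R) l W S : {set I} :=
  if l is i :: l' then
    policy p F theta l'
      (if (i \in S) && accepts p F theta l' W i then i |: W else W) S
  else W.

Section Policy.
Variables (p : I -> R) (F : {set {set I}}) (theta : R).
Hypothesis p01 : forall i, 0 <= p i <= 1.
Hypothesis dF : down_closed F.
Hypothesis theta_gt0 : 0 < theta.

Lemma policy_subset l W S :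
  (W \subset policy p F theta l W S) &&
  (policy p F theta l W S \subset W :|: [set i in l | i \in S]).
Proof.
elim: l W => [|i l IHl] W /=.
  by rewrite fintype.subxx finset.subsetUl.
set W' := if _ then _ else _.
have [le1 le2] := andP (IHl W'); apply/andP; split.
  apply: fintype.subset_trans le1; rewrite /W'; case: ifP => // _; exact: finset.subsetUr.
apply: (fintype.subset_trans le2); apply/fintype.subsetP => j.
rewrite /W'; case: (boolP (i \in S)) => iS /=; last first.
  by rewrite !finset.inE; case/orP=> [->//|/andP[-> ->]]; rewrite !orbT.
case: ifP => _; rewrite !finset.inE.
  case/orP=> [/predU1P[->|->//]|/andP[-> ->]]; last by rewrite !orbT.
  by rewrite eqxx iS orbT.
by case/orP=> [->//|/andP[-> ->]]; rewrite !orbT.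
Qed.

Lemma policy_feasible l W S : W \in F -> policy p F theta l W S \in F.
Proof.
elim: l W => [|i l IHl] W //= WF; apply: IHl.
by case: ifP => // /andP[_ /andP[]].
Qed.

Lemma eq_policy l W S T : (forall i, i \in l -> (i \in S) = (i \in T)) ->
  policy p F theta l W S = policy p F theta l W T.
Proof.
elim: l W => [|i l IHl] W //= ST; rewrite ST ?mem_head // IHl // => j jl.
by rewrite ST // inE jl orbT.
Qed.

(** This is what makes the policy online: later arrivals neither add nor remove [i], and decisions
    within [l1] consult the active set only on [l1]. *)
Lemma mem_policy_prefix l1 l2 W S T i : i \notin l2 ->
  (forall j, j \in l1 -> (j \in S) = (j \in T)) ->
  (i \in policy p F theta (l1 ++ l2) W S) =
  (i \in policy p F theta (l1 ++ l2) W T).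
Proof.
move=> il2; elim: l1 W => [|j l1 IHl] W ST /=; last first.
  rewrite ST ?mem_head //; apply: IHl => k kl; apply: ST.
  by rewrite inE kl orbT.
have memW U : (i \in policy p F theta l2 W U) = (i \in W).
  have /andP[le1 le2] := policy_subset l2 W U.
  apply/idP/idP => [/(fintype.subsetP le2)|/(fintype.subsetP le1)//].
  by rewrite !finset.inE (negPf il2) orbF.
by rewrite !memW.
Qed.

Lemma partition_function_ge1 l W : 1 <= partition_function p F l W.
Proof.
elim: l W => [|i l IHl] W //=; apply: ler_wpDr => //.
case: ifP => // _; rewrite !mulr_ge0 ?expR_ge0 //; first by case/andP: (p01 i).
exact: le_trans (IHl _).
Qed.

Let Z_gt0 l W : 0 < partition_function p F l W.
Proof. exact: lt_le_trans (partition_function_ge1 l W). Qed.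

Lemma partition_function_anti l W W' : W \subset W' ->
  partition_function p F l W' <= partition_function p F l W.
Proof.
elim: l W W' => [|i l IHl] W W' WW' //=; rewrite lerD ?IHl //.
have iWW' : i |: W \subset i |: W' by rewrite finset.setUS.
have ep0 : 0 <= expR 1 * p i by rewrite mulr_ge0 ?expR_ge0 //; case/andP: (p01 i).
have [iF'|_] := boolP (i |: W' \in F).
  by rewrite (dF iWW' iF') ler_wpM2l ?IHl.
by case: ifP => // _; rewrite mulr_ge0 // ltW.
Qed.

(** Averaging [expR_extension_rank] over the coin of [i] turns [(1 - p i) * m + p i * (m + e * m')]
    into [m + e * p i * m'], which is the recursion of the partition function. *)
Lemma subset_mean_extension_rank l W :
  subset_mean p l (fun S => expR (extension_rank F W S)%:R) <=
  partition_function p F l W.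
Proof.
elim: l W => [|i l IHl] W /=.
  rewrite -[leRHS]expR0 ler_expR /extension_rank big1 // => T /andP[T0 _].
  by move: T0; rewrite finset.subset0 => /eqP ->; rewrite cards0.
have [p0 p1] := andP (p01 i).
set m := subset_mean p l _; set m' := subset_mean p l _.
suff m'm : m' <= m + (if i |: W \in F then expR 1 * partition_function p F l (i |: W) else 0).
  apply: (@le_trans _ _ ((1 - p i) * m + p i *
    (m + (if i |: W \in F then expR 1 * partition_function p F l (i |: W) else 0)))).
    by rewrite lerD2l ler_wpM2l.
  rewrite mulrDr addrA -mulrDl subrK mul1r lerD ?IHl //.
  by case: ifP => _; rewrite ?mulr0 // mulrCA mulrA.
apply: (@le_trans _ _ (subset_mean p l (fun S => expR (extension_rank F W S)%:R +
  (if i |: W \in F then expR 1 * expR (extension_rank F (i |: W) S)%:R else 0)))).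
  by apply: ler_subset_mean => // S _; apply: expR_extension_rank.
rewrite subset_mean_add lerD2l; case: ifP => _; last first.
  rewrite (@eq_subset_mean _ p01 _ _ (fun S => 0 * 0 + 0)) => [|S _]; last by rewrite mul0r addr0.
  by rewrite subset_mean_lin mul0r addr0.
rewrite (@eq_subset_mean _ p01 _ _
  (fun S => expR 1 * expR (extension_rank F (i |: W) S)%:R + 0)) => [|S _]; last by rewrite addr0.
by rewrite subset_mean_lin addr0 ler_wpM2l ?expR_ge0 ?IHl.
Qed.

                                                                               
                                                                             
                                                                               
(** Potential argument: [alpha * ln Z] is a lower bound on the expected future gain, up to a
    correction charged to rejections. The condition on [alpha] says that the unit gained by
    accepting pays both for the drop [- ln theta] and for the term [expR 1 * p i] by which [ln Z]
    may shrink when [i] leaves the list. *)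
Lemma ler_policy_mean (alpha : R) l W : 0 <= alpha ->
  alpha * (expR 1 - ln theta) <= 1 -> uniq l -> (forall i, i \in l -> i \notin W) ->
  #|W|%:R + alpha * (ln (partition_function p F l W) -
    expR 1 * theta * \sum_(i <- l | [set i] \in F) p i) <=
  subset_mean p l (fun S => #|policy p F theta l W S|%:R).
Proof.
move=> a0 a1; elim: l W => [|i l IHl] W /=.
  by move=> _ _; rewrite ln1 big_nil mulr0 subr0 mulr0 addr0.
move=> /andP[il ul] lW; have [p0 p1] := andP (p01 i).
have iW : i \notin W by rewrite lW ?mem_head.
have lW1 j : j \in l -> j \notin W by move=> jl; rewrite lW // inE jl orbT.
have lW2 j : j \in l -> j \notin i |: W.
  move=> jl; rewrite in_setU1 negb_or lW1 // andbT.
  by apply: contraNneq il => <-.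
have := IHl _ ul lW1; have := IHl _ ul lW2.
set sl := \sum_(_ <- _ | _) _; set sl' := \sum_(_ <- _ | _) _.
set Z := partition_function p F l W; set Z' := partition_function p F l (i |: W).
have Z0 : 0 < Z by exact: Z_gt0.
have Z'0 : 0 < Z' by exact: Z_gt0.
have Z'Z : Z' <= Z by apply: partition_function_anti; exact: finset.subsetUr.
have e0 := expR_gt0 (1 : R).
have ep0 : 0 <= expR 1 * p i by rewrite mulr_ge0 // ltW.
have et0 : 0 <= expR 1 * theta by rewrite mulr_ge0 // ltW.
rewrite cardsU1 iW natrD.
set m' := subset_mean p l (fun S => #|policy p F theta l (i |: W) S|%:R).
set m := subset_mean p l (fun S => #|policy p F theta l W S|%:R).
move=> le_m' le_m.
have -> : subset_mean p l (fun S => #|policy p F theta l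
    (if (i \in S) && accepts p F theta l W i then i |: W else W) S|%:R) = m.
  apply: eq_subset_mean => // S Sl; case: (boolP (i \in S)) => //= iS.
  by rewrite (fintype.subsetP Sl) in il.
have -> : subset_mean p l (fun S => #|policy p F theta l
    (if (i \in i |: S) && accepts p F theta l W i then i |: W else W) (i |: S)|%:R) =
    if accepts p F theta l W i then m' else m.
  transitivity (subset_mean p l (fun S => #|policy p F theta l
      (if accepts p F theta l W i then i |: W else W) S|%:R)); last by case: ifP.
  apply: eq_subset_mean => // S Sl; rewrite setU11 /=.
  rewrite (@eq_policy _ _ (i |: S) S) // => j jl; rewrite in_setU1; case: eqP => // ji.
  by rewrite -ji jl in il.
have sl'E : sl' = sl + (if [set i] \in F then p i else 0).
  by rewrite /sl' big_cons; case: ifP => _; rewrite ?addr0 // addrC.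
have [iF|iF] := boolP (i |: W \in F); last first.
  (* An item that does not fit leaves the partition function unchanged, and its possible
     contribution to the subtracted sum only weakens the bound. *)
  rewrite /accepts (negPf iF) /= addr0 -mulrDl subrK mul1r.
  apply: le_trans le_m; rewrite lerD2l ler_wpM2l // lerB // ler_wpM2l //.
  by rewrite sl'E lerDl; case: ifP.
have i1F : [set i] \in F by apply: dF iF; exact: finset.subsetUl.
rewrite i1F in sl'E; rewrite /accepts iF /= -/Z -/Z' {}sl'E.
(* Factor out [Z] and use [ln (1 + x) <= x]. *)
have lnZ : ln (Z + expR 1 * p i * Z') <= ln Z + expR 1 * p i * (Z' / Z).
  have -> : Z + expR 1 * p i * Z' = Z * (1 + expR 1 * p i * (Z' / Z)).
    by field; rewrite gt_eqF.
  have r0 : 0 <= expR 1 * p i * (Z' / Z) by rewrite !mulr_ge0 ?invr_ge0 // ltW.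
  rewrite lnM ?posrE ?ltr_wpDr // lerD2l.
  by rewrite -[leRHS]expRK ler_ln ?posrE ?expR_gt0 ?expR_ge1Dx // ltr_wpDr.
set r := Z' / Z in lnZ.
case: ifP => [acc|/negbT]; last first.
  (* Rejection means [r < theta], so the loss of potential is at most [expR 1 * theta * p i], the
     summand of [i] in the correction. *)
  rewrite -ltNge => rej; rewrite -mulrDl subrK mul1r; apply: le_trans le_m.
  rewrite lerD2l ler_wpM2l //.
  have : expR 1 * p i * r <= expR 1 * p i * theta.
    by rewrite ler_wpM2l ?ep0 // ltW // /r ltr_pdivrMr.
  by move: lnZ; lra.
(* Acceptance: the potential drops by at most [- ln theta], and only with probability [p i]. *)
have lnZ' : ln Z + ln theta <= ln Z'.
  by rewrite -lnM ?posrE // ler_ln ?posrE ?mulr_gt0 // mulrC.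
have r1 : r <= 1 by rewrite /r ler_pdivrMr // mul1r.
apply: (@le_trans _ _ ((1 - p i) * (#|W|%:R + alpha * (ln Z - expR 1 * theta * sl)) +
   p i * (1 + #|W|%:R + alpha * (ln Z' - expR 1 * theta * sl)))); last first.
  by rewrite lerD // ler_wpM2l // subr_ge0.
apply: (@le_trans _ _ (#|W|%:R + alpha * (ln Z + expR 1 * p i - expR 1 * theta * sl))).
  rewrite lerD2l ler_wpM2l // lerB //.
    by apply: le_trans lnZ _; rewrite lerD2l ler_piMr.
  by rewrite ler_wpM2l ?et0 // lerDl.
have : p i * (alpha * (ln Z + ln theta)) <= p i * (alpha * ln Z') by rewrite !ler_wpM2l.
have : p i * (alpha * (expR 1 - ln theta)) <= p i * 1 by rewrite ler_wpM2l.
lra.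
Qed.

End Policy.

End RandomSubset.

(** * The online algorithm and its link with prophet instances *)

Definition item_prob (R : realType) (n : nat) (D : 'I_n -> probability R R)
    (i : 'I_n) : R :=
  fine (D i [set 1]%classic).

Definition active (R : realType) (n : nat) (x : 'I_n -> R) : {set 'I_n} :=
  [set i | x i == 1].

                                                                              
                                                                     
(** Each decision replays the policy from the start. The default 0 of [nth] declares the unobserved
    items inactive, which does not affect the decision on [i] by [mem_policy_prefix]. *)
Definition partition_algorithm (R : realType) : online_algorithm R :=
  fun n F D i s =>
    i \in policy (item_prob D) F (2 * expR 1 * n%:R)^-1 (enum 'I_n) finset.set0
      (active (fun j => nth 0 s j)).

Lemma item_prob_itv (R : realType) (n : nat) (D : 'I_n -> probability R R) i :
  0 <= item_prob D i <= 1.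
Proof.
rewrite /item_prob fine_ge0 ?measure_ge0 //= -lee_fin fineK ?fin_num_measure //.
by rewrite probability_le1 //; exact: measurable_set1.
Qed.

Lemma selected_policy (R : realType) (n : nat) (I : prophet_instance R n)
    (x : 'I_n -> R) (k : nat) :
  selected (@partition_algorithm R) I x k =
  [set i in policy (item_prob (item_distribution I)) (feasible I)
     (2 * expR 1 * n%:R)^-1 (enum 'I_n) finset.set0 (active x) | (i < k)%N].
Proof.
apply/setP => i; rewrite !finset.inE andbC; congr (_ && _).
rewrite /partition_algorithm.
set p := item_prob _; set F := feasible I; set th := _^-1.
have inT (j : 'I_n) : (j \in take i.+1 (enum 'I_n)) = (j < i.+1)%N.
  by rewrite in_take ?mem_enum // index_enum_ord.
have inD (j : 'I_n) : j \in drop i.+1 (enum 'I_n) -> (i < j)%N.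
  move=> jD; rewrite ltnNge; apply/negP => ji.
  have := enum_uniq 'I_n; rewrite -(cat_take_drop i.+1 (enum 'I_n)) cat_uniq.
  by case/and3P=> _ /hasPn /(_ _ jD); rewrite /= inT ltnS ji.
(* The arrival order is cut just after [i], so the prefix consists exactly of the observed items. *)
rewrite -(cat_take_drop i.+1 (enum 'I_n)); apply: mem_policy_prefix => [|j].
  by apply/negP => /inD; rewrite ltnn.
rewrite inT => ji; rewrite !finset.inE /observed (nth_map i) ?nth_take ?nth_ord_enum //.
by rewrite size_take size_enum_ord; case: ifP.
Qed.

(** The events [A S] that the active set equals [S] partition the sample space, and by independence
    each has the product probability occurring in [subset_mean_sum]. *)
Lemma expectation_active (R : realType) (n : nat) (I : prophet_instance R n)
    (g : {set 'I_n} -> R) : zero_one_valued I ->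
  'E_(sample_prob I)[fun w => g (active (realization w))]%E =
  (subset_mean (item_prob (item_distribution I)) (enum 'I_n) g)%:E.
Proof.
move=> zo; set P := sample_prob I; set p := item_prob _.
pose B (S : {set 'I_n}) (i : 'I_n) : set R := [set (i \in S)%:R]%classic.
pose A (S : {set 'I_n}) : set (sample_space I) :=
  (\bigcap_(i in [set` [set: 'I_n]%SET]) (item_value I i @^-1` B S i))%classic.
have mB S i : measurable (B S i) by exact: measurable_set1.
have mXB S i : measurable (item_value I i @^-1` B S i)%classic.
  by rewrite -[X in measurable X]setTI; exact: measurable_funP.
have mA S : measurable (A S) by apply: fin_bigcap_measurable => // i _; exact: mXB.
have AE S w : A S w <-> active (realization w) = S.
  split=> [AS|<- i _] /=.
    apply/setP => i; rewrite finset.inE; have := AS i; rewrite /= finset.inE => /(_ isT).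
    by rewrite /B /realization /= => ->; case: (i \in S); rewrite ?eqxx // eq_sym oner_eq0.
  rewrite /B /= finset.inE /realization; case: (zo i w) => ->; rewrite ?eqxx //.
  by rewrite eq_sym oner_eq0.
have PX i (b : bool) : P (item_value I i @^-1` [set b%:R]%classic)%classic =
    (if b then p i else 1 - p i)%:E.
  have P1 : P (item_value I i @^-1` [set 1]%classic)%classic = (p i)%:E.
    rewrite /p /item_prob fineK //; apply: fin_num_measure; exact: measurable_set1.
  case: b => //.
  have -> : (item_value I i @^-1` [set 0])%classic = (~` (item_value I i @^-1` [set 1]))%classic.
    apply/seteqP; split => w /=; first by move=> ->; apply/eqP; rewrite eq_sym oner_eq0.
    by case: (zo i w).
  rewrite probability_setC; first by rewrite P1.
  by rewrite -[X in measurable X]setTI; apply: measurable_funP => //; exact: measurable_set1.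
have PA S : P (A S) = (\prod_i (if i \in S then p i else 1 - p i))%:E.
  rewrite /A (@item_indep _ _ I) // -prodEFin; apply: eq_big => [i|i _]; first by rewrite finset.inE.
  exact: PX.
rewrite subset_mean_sum ?enum_uniq // unlock.
under eq_integral => w _.
  rewrite (_ : (g (active (realization w)))%:E =
    (\sum_(S : {set 'I_n}) (g S)%:E * (\1_(A S) w)%:E)%E); last first.
    rewrite (bigD1 (active (realization w))) //= indicE mem_set ?mule1; last exact/AE.
    rewrite big1 ?adde0 // => S Sw; rewrite indicE memNset ?mule0 //.
    by move=> /AE E; rewrite E eqxx in Sw.
  over.
rewrite integral_sum //=; last first.
  by move=> S; apply: integrableZl => //; exact: integrable_indic.
rewrite -sumEFin; apply: eq_big => [S|S _].
  by apply/esym/fintype.subsetP => i _; rewrite mem_enum.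
rewrite integralZl //; last exact: integrable_indic.
by rewrite integral_indic // setIT [X in (_ * X)%E]PA -EFinM big_enum.
Qed.

(** * Choice of the threshold and the logarithmic ratio *)

Lemma policy_mean_lower_bound (R : realType) (n : nat) (p : 'I_n -> R) F :
  (0 < n)%N -> (forall i, 0 <= p i <= 1) -> down_closed F ->
  subset_mean p (enum 'I_n) (fun S => (extension_rank F finset.set0 S)%:R) <=
  2 * (expR 1 + 1 + ln 2 + ln n%:R) * subset_mean p (enum 'I_n)
    (fun S => #|policy p F (2 * expR 1 * n%:R)^-1 (enum 'I_n) finset.set0 S|%:R).
Proof.
move=> n0 p01 dF; set mu := subset_mean _ _ _; set v := subset_mean _ _ _.
have e0 := expR_gt0 (1 : R).
have n0R : 0 < n%:R :> R by rewrite ltr0n.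
have lnn : 0 <= ln n%:R :> R by rewrite ln_ge0 // ler1n.
have ln2 : 0 <= ln 2 :> R by rewrite ln_ge0 // ler1n.
set theta := _^-1 in v *; set b := _ + _ + _ + _.
have b0 : 0 < b by rewrite /b; lra.
have th0 : 0 < theta by rewrite invr_gt0 !mulr_gt0.
have lnth : expR 1 - ln theta = b.
  by rewrite /theta lnV ?posrE ?mulr_gt0 // !lnM ?posrE ?mulr_gt0 // expRK /b; ring.
(* If [[set i]] is feasible, the rank is at least 1 whenever [i] is active. *)
have mu_p (i : 'I_n) : [set i] \in F -> p i <= mu.
  move=> iF; rewrite -(@subset_mean_mem _ _ p p01 (enum 'I_n) i) ?enum_uniq ?mem_enum //.
  apply: ler_subset_mean => // S _; rewrite ler_nat; case: (boolP (i \in S)) => // iS.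
  have /= := @leq_extension_rank _ F finset.set0 S [set i].
  by rewrite cards1 finset.set0U finset.sub1set; apply.
have mu0 : 0 <= mu.
  by apply: subset_mean_ge0.
have sum_le : \sum_(i <- enum 'I_n | [set i] \in F) p i <= n%:R * mu.
  apply: (@le_trans _ _ (\sum_(i <- enum 'I_n) mu)).
    rewrite [leRHS](bigID (fun i => [set i] \in F)) /=.
    by apply: ler_wpDr; [exact: sumr_ge0 | exact: ler_sum].
  by rewrite big_const_seq count_predT size_enum_ord iter_addr_0 mulr_natl.
have mu_ln : mu <= ln (partition_function p F (enum 'I_n) finset.set0).
  rewrite -[leLHS]expRK ler_ln ?posrE ?expR_gt0 //; last first.
    exact: lt_le_trans (partition_function_ge1 _ p01 _ _).
  apply: le_trans (expR_subset_mean p01 _ _) _; exact: subset_mean_extension_rank.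
(* With [alpha = b^-1] the condition on [alpha] holds with equality. *)
have := @ler_policy_mean _ _ p F theta p01 dF th0 b^-1 (enum 'I_n) finset.set0.
rewrite lnth mulVf ?gt_eqF // invr_ge0 (ltW b0) enum_uniq cards0 add0r -/v.
move=> /(_ isT (lexx _) isT) H.
have {H} := H (fun i _ => negbT (finset.in_set0 i)).
rewrite mulrC ler_pdivrMr //.
(* This bound dictates the value of [theta]: rejections cost at most half of [mu]. *)
have : expR 1 * theta * (\sum_(i <- enum 'I_n | [set i] \in F) p i) <= mu / 2.
  apply: (le_trans (y := expR 1 * theta * (n%:R * mu))).
    by rewrite ler_wpM2l // mulr_ge0 // ltW.
  rewrite le_eqVlt; apply/orP; left; apply/eqP.
  by rewrite /theta; field; rewrite (gt_eqF n0R) (gt_eqF e0).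
by move: mu_ln; lra.
Qed.

Theorem theorem2p2 (R : realType) :
  exists A : online_algorithm R,
    (forall (n : nat) (I : prophet_instance R n),
       zero_one_valued I -> respects_constraints A I) /\
    exists C : R, forall n : nat, (2 <= n)%N ->
      (competitive_ratio A (@zero_one_valued R n) <= (C * ln n%:R)%:E)%E.
Proof.
exists (@partition_algorithm R); split=> [n I _ w k _|].
  rewrite selected_policy; apply: (@feasible_down _ _ I _ _ _ (policy_feasible _ _ _ _ (feasible0 I))).
  by apply/fintype.subsetP => i; rewrite finset.inE => /andP[iP _]; exact: iP.
have ln2 : 0 < ln 2 :> R by rewrite ln_gt0 // ltr1n.
pose c : R := expR 1 + 1 + ln 2.
have c0 : 0 < c by rewrite /c; have := expR_gt0 (1 : R); lra.
(* Since [n >= 2], the constant [c] is at most [c / ln 2 * ln n], so it is absorbed into the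
   logarithm. *)
exists (2 * (c / ln 2 + 1)) => n n2.
apply: ge_ereal_sup => _ [I zo ->].
set p := item_prob (item_distribution I).
set th : R := (2 * expR 1 * n%:R)^-1.
have p01 := item_prob_itv (item_distribution I).
pose opt (S : {set 'I_n}) : R :=
  \big[Num.max/0]_(T in feasible I) \sum_(i in T) (i \in S)%:R.
pose alg (S : {set 'I_n}) : R :=
  #|policy p (feasible I) th (enum 'I_n) finset.set0 S|%:R.
have xE (w : sample_space I) i : realization w i = (i \in active (realization w))%:R :> R.
  by rewrite finset.inE /realization; case: (zo i w) => ->; rewrite ?eqxx // eq_sym oner_eq0.
have -> : expected_optimum I = (subset_mean p (enum 'I_n) opt)%:E.
  rewrite -expectation_active // /expected_optimum; congr expectation.
  apply/funext => w; apply: eq_bigr => T _; apply: eq_bigr => i _; exact: xE.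
have -> : expected_value (@partition_algorithm R) I = (subset_mean p (enum 'I_n) alg)%:E.
  rewrite -expectation_active // /expected_value; congr expectation.
  apply/funext => w; rewrite selected_policy /alg -sum1_card natr_sum.
  apply: eq_big => [i|i]; first by rewrite finset.inE ltn_ord andbT.
  rewrite finset.inE => /andP[iS _].
  have /andP[_ /fintype.subsetP/(_ _ iS)] :=
    policy_subset p (feasible I) th (enum 'I_n) finset.set0 (active (realization w)).
  by rewrite xE finset.set0U finset.inE => /andP[_ ->].
set mu := subset_mean p _ opt; set v := subset_mean p _ alg.
have opt0 S : 0 <= opt S.
  rewrite /opt; elim/big_rec: _ => // T x _ x0; by rewrite le_max x0 orbT.
have mu0 : 0 <= mu by exact: subset_mean_ge0.
have v0 : 0 <= v by apply: subset_mean_ge0.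
(* A feasible [T] collects [#|T :&: S|], and [T :&: S] is itself feasible, so the optimum is at most
   the rank of the active set over the empty selection. *)
have mu_v : mu <= 2 * (c + ln n%:R) * v.
  apply: le_trans (policy_mean_lower_bound (ltnW n2) p01 (@feasible_down _ _ I)).
  apply: ler_subset_mean => // S _; rewrite /opt.
  elim/big_rec: _ => [|T x TF xr]; first exact: ler0n.
  rewrite ge_max xr andbT -natr_sum ler_nat.
  have -> : (\sum_(i in T) (i \in S) = #|T :&: S|)%N.
    by rewrite -big_mkcondr sum1_card; apply: eq_card => i; rewrite finset.inE.
  rewrite leq_extension_rank ?finset.subsetIr // finset.set0U.
  by apply: (@feasible_down _ _ I _ T) => //; exact: finset.subsetIl.
have lnn : ln 2 <= ln n%:R :> R by rewrite ler_ln ?posrE ?ltr0n ?ler_nat // ltnW.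
have cC : 2 * (c + ln n%:R) <= 2 * (c / ln 2 + 1) * ln n%:R.
  have : c / ln 2 * ln 2 <= c / ln 2 * ln n%:R by rewrite ler_wpM2l // divr_ge0 // ltW.
  by rewrite divfK ?gt_eqF //; lra.
(* If the algorithm's expected value is 0, so is the optimum by [mu_v], and the ratio is
   [0 * +oo = 0]. *)
rewrite inver; case: eqP => [vE|/eqP vN0].
  have -> : mu = 0 by apply/le_anti; rewrite mu0 andbT (le_trans mu_v) // vE mulr0.
  by rewrite mul0e lee_fin (le_trans _ cC) // mulr_ge0 // addr_ge0 ?ltW // (lt_le_trans ln2).
rewrite -EFinM lee_fin ler_pdivrMr; last by rewrite lt_neqAle eq_sym vN0.
by apply: (le_trans mu_v); rewrite ler_wpM2r.
Qed.
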